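(* For a Barr-exact category $\mathbb{C}$ the following are equivalent: (1) $\mathbb{C}$ is arithmetical (i.e. Mal'tsev and congruence distributive); (2) $\mathbb{C}$ is Mal'tsev and a majority category.
   Context: A Barr-exact category is a regular category in which every internal equivalence relation is a kernel pair. A binary relation between objects $X$ and $Y$ of a category is a triple $R=(R_0,r_1,r_2)$ with $r_1:R_0\to X$, $r_2:R_0\to Y$ jointly monomorphic; a pair $(x,y)$ of morphisms $x:S\to X$, $y:S\to Y$ is $R$-related if there is $f:S\to R_0$ with $r_1f=x$, $r_2f=y$. The relation $R$ is difunctional if for all $x_1,x_2:S\to X$ and $y_1,y_2:S\to Y$, if $(x_1,y_2)$, $(x_1,y_1)$ and $(x_2,y_1)$ are $R$-related then $(x_2,y_2)$ is $R$-related. A category is Mal'tsev if every internal binary relation in it is difunctional. A Barr-exact Mal'tsev category is congruence distributive if for each object the lattice of (internal) equivalence relations on it is distributive (in a regular Mal'tsev category the join of two equivalence relations is their composite). An arithmetical category is a Barr-exact Mal'tsev category which is congruence distributive. A ternary relation between objects $A,B,C$ is a quadruple $R=(R_0,r_1,r_2,r_3)$ with $r_1:R_0\to A$, $r_2:R_0\to B$, $r_3:R_0\to C$ jointly monomorphic; a triple $(a,b,c)$ of morphisms $a:S\to A$, $b:S\to B$, $c:S\to C$ is $R$-related if there is $f:S\to R_0$ with $r_1f=a$, $r_2f=b$, $r_3f=c$. A category is a majority category if for any ternary relation $R$ between any objects $A,B,C$ and any morphisms $a_1,a_2:S\to A$, $b_1,b_2:S\to B$, $c_1,c_2:S\to C$: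 if $(a_1,b_1,c_2)$, $(a_1,b_2,c_1)$ and $(a_2,b_1,c_1)$ are $R$-related, then $(a_1,b_1,c_1)$ is $R$-related. *)

(* Defs.v *)
From mathcomp Require Import all_boot.

Set Implicit Arguments.
Unset Strict Implicit.
Unset Printing Implicit Defensive.

Declare Scope cat_scope.
Delimit Scope cat_scope with cat.

Record category := Category {
  ob :> Type;
  hom : ob -> ob -> Type;
  idm : forall X : ob, hom X X;
  comp : forall X Y Z : ob, hom Y Z -> hom X Y -> hom X Z;
  comp_idl : forall (X Y : ob) (f : hom X Y), comp (idm Y) f = f;
  comp_idr : forall (X Y : ob) (f : hom X Y), comp f (idm X) = f;
  comp_assoc : forall (W X Y Z : ob) (h : hom Y Z) (g : hom X Y) (f : hom W X),
    comp h (comp g f) = comp (comp h g) f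
}.

Arguments idm {c} X.
Arguments comp {c X Y Z} g f.

Notation "g ∘ f" := (comp g f) (at level 40, left associativity) : cat_scope.
Local Open Scope cat_scope.

(* A diagram is indexed by a finite graph.  This covers the diagrams indexed by
   a finite category, whose limits depend only on the underlying graph. *)
Record diagram (C : category) (V E : finType) (src tgt : E -> V) := Diagram {
  dob : V -> C;
  dmor : forall e : E, hom (dob (src e)) (dob (tgt e))
}.

Definition is_cone (C : category) (V E : finType) (src tgt : E -> V)
    (D : diagram C src tgt) (L : C) (p : forall v : V, hom L (dob D v)) : Prop :=
  forall e : E, dmor D e ∘ p (src e) = p (tgt e).

Definition is_limit (C : category) (V E : finType) (src tgt : E -> V)
    (D : diagram C src tgt) (L : C) (p : forall v : V, hom L (dob D v)) : Prop :=
  is_cone p /\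
  forall (S : C) (q : forall v : V, hom S (dob D v)), is_cone q ->
    exists! h : hom S L, forall v : V, p v ∘ h = q v.

Definition has_finite_limits (C : category) : Prop :=
  forall (V E : finType) (src tgt : E -> V) (D : diagram C src tgt),
    exists (L : C) (p : forall v : V, hom L (dob D v)), is_limit p.

Definition is_pullback (C : category) (X Y Z P : C) (f : hom X Z) (g : hom Y Z)
    (p : hom P X) (q : hom P Y) : Prop :=
  f ∘ p = g ∘ q /\
  forall (S : C) (u : hom S X) (v : hom S Y), f ∘ u = g ∘ v ->
    exists! h : hom S P, p ∘ h = u /\ q ∘ h = v.

Definition is_kernel_pair (C : category) (X Y K : C) (f : hom X Y)
    (k1 k2 : hom K X) : Prop :=
  is_pullback f f k1 k2.

Definition is_coequalizer (C : category) (Z X Q : C) (u v : hom Z X)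
    (q : hom X Q) : Prop :=
  q ∘ u = q ∘ v /\
  forall (T : C) (g : hom X T), g ∘ u = g ∘ v -> exists! h : hom Q T, h ∘ q = g.

Definition regular_epi (C : category) (X Y : C) (f : hom X Y) : Prop :=
  exists (Z : C) (u v : hom Z X), is_coequalizer u v f.

Definition regular (C : category) : Prop :=
  [/\ has_finite_limits C,
      forall (X Y K : C) (f : hom X Y) (k1 k2 : hom K X),
        is_kernel_pair f k1 k2 ->
        exists (Q : C) (q : hom X Q), is_coequalizer k1 k2 q
    & forall (X Y Z P : C) (f : hom X Z) (g : hom Y Z) (p : hom P X) (q : hom P Y),
        is_pullback f g p q -> regular_epi f -> regular_epi q].

Record relation2 (C : category) (X Y : C) := Relation2 {
  rel2_ob : C;
  rel2_1 : hom rel2_ob X;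
  rel2_2 : hom rel2_ob Y;
  rel2_monic : forall (S : C) (f g : hom S rel2_ob),
    rel2_1 ∘ f = rel2_1 ∘ g -> rel2_2 ∘ f = rel2_2 ∘ g -> f = g
}.

Definition related2 (C : category) (X Y : C) (R : relation2 X Y) (S : C)
    (x : hom S X) (y : hom S Y) : Prop :=
  exists f : hom S (rel2_ob R), rel2_1 R ∘ f = x /\ rel2_2 R ∘ f = y.

Record relation3 (C : category) (X Y Z : C) := Relation3 {
  rel3_ob : C;
  rel3_1 : hom rel3_ob X;
  rel3_2 : hom rel3_ob Y;
  rel3_3 : hom rel3_ob Z;
  rel3_monic : forall (S : C) (f g : hom S rel3_ob),
    rel3_1 ∘ f = rel3_1 ∘ g -> rel3_2 ∘ f = rel3_2 ∘ g ->
    rel3_3 ∘ f = rel3_3 ∘ g -> f = g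
}.

Definition related3 (C : category) (X Y Z : C) (R : relation3 X Y Z) (S : C)
    (x : hom S X) (y : hom S Y) (z : hom S Z) : Prop :=
  exists f : hom S (rel3_ob R),
    [/\ rel3_1 R ∘ f = x, rel3_2 R ∘ f = y & rel3_3 R ∘ f = z].

Record eqrel (C : category) (X : C) := EqRel {
  eqrel_rel :> relation2 X X;
  eqrel_refl : forall (S : C) (x : hom S X), related2 eqrel_rel x x;
  eqrel_sym : forall (S : C) (x y : hom S X),
    related2 eqrel_rel x y -> related2 eqrel_rel y x;
  eqrel_trans : forall (S : C) (x y z : hom S X),
    related2 eqrel_rel x y -> related2 eqrel_rel y z -> related2 eqrel_rel x z
}.

Definition barr_exact (C : category) : Prop :=
  regular C /\
  forall (X : C) (R : eqrel X),
    exists (Y : C) (f : hom X Y), is_kernel_pair f (rel2_1 R) (rel2_2 R).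

(* Inclusion of relations as subobjects: the legs of R factor through S.  It is
   a preorder; relations that are below each other are isomorphic. *)
Definition rel_le (C : category) (X Y : C) (R S : relation2 X Y) : Prop :=
  related2 S (rel2_1 R) (rel2_2 R).

Definition is_meet (C : category) (X : C) (R S M : eqrel X) : Prop :=
  [/\ rel_le M R, rel_le M S
    & forall N : eqrel X, rel_le N R -> rel_le N S -> rel_le N M].

Definition is_join (C : category) (X : C) (R S J : eqrel X) : Prop :=
  [/\ rel_le R J, rel_le S J
    & forall N : eqrel X, rel_le R N -> rel_le S N -> rel_le J N].

(* Meets and joins are determined up to isomorphism of relations, so the law
   R /\ (S \/ T) = (R /\ S) \/ (R /\ T) is stated for every choice of them, with
   equality as mutual inclusion. *)
Definition eqrel_distributive_lattice (C : category) (X : C) : Prop :=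
  [/\ forall R S : eqrel X, exists M : eqrel X, is_meet R S M,
      forall R S : eqrel X, exists J : eqrel X, is_join R S J
    & forall R S T ST RS RT L M : eqrel X,
        is_join S T ST -> is_meet R ST L ->
        is_meet R S RS -> is_meet R T RT -> is_join RS RT M ->
        rel_le L M /\ rel_le M L].

Definition congruence_distributive (C : category) : Prop :=
  forall X : C, eqrel_distributive_lattice X.

Definition difunctional (C : category) (X Y : C) (R : relation2 X Y) : Prop :=
  forall (S : C) (x1 x2 : hom S X) (y1 y2 : hom S Y),
    related2 R x1 y2 -> related2 R x1 y1 -> related2 R x2 y1 ->
    related2 R x2 y2.

Definition maltsev (C : category) : Prop :=
  forall (X Y : C) (R : relation2 X Y), difunctional R.

Definition arithmetical (C : category) : Prop :=
  [/\ barr_exact C, maltsev C & congruence_distributive C].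

Definition majority (C : category) : Prop :=
  forall (X Y Z : C) (R : relation3 X Y Z) (S : C)
    (a1 a2 : hom S X) (b1 b2 : hom S Y) (c1 c2 : hom S Z),
    related3 R a1 b1 c2 -> related3 R a1 b2 c1 -> related3 R a2 b1 c1 ->
    related3 R a1 b1 c1.

(* Main.v *)
From mathcomp Require Import all_boot.
Require Import Defs.

Set Implicit Arguments.
Unset Strict Implicit.
Unset Printing Implicit Defensive.

Local Open Scope cat_scope.

(** The argument is the one of universal algebra, carried out with generalized
    elements.

    In a regular category, a relation defined by an existential formula is an
    image, and an element belongs to it exactly when a witness exists after
    composing with some regular epimorphism ([image_factorization],
    [local_lift]).  Conversely, membership in a relation can be checked after
    composing with a regular epimorphism ([related2_descent],
    [related3_descent]), so that when the conclusion is a membership such local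
    witnesses may be used as if they were global.

    In a Mal'tsev category every reflexive relation is an equivalence relation
    ([maltsev_eqrel]).  Hence the composite of two equivalence relations is one,
    and it is their join: x and z are related by S \/ T exactly when, locally,
    x S y and y T z for some y ([join_related]).

    From distributivity to majority ([distributive_majority]): three elements
    f1 = (a1,b1,c2), f2 = (a1,b2,c1), f3 = (a2,b1,c1) of a ternary relation are
    linked by the kernel pairs A, B, C of its three legs: f1 A f2 and
    f1 B f3 C f2.  So f1 and f2 are related by A /\ (B \/ C), hence by
    (A /\ B) \/ (A /\ C), which gives locally a w with
    f1 (A /\ B) w (A /\ C) f2.  The three coordinates of w are a1, b1, c1.

    From majority to distributivity ([majority_distributive]): suppose that
    x R z and x S y T z.  The ternary relation
    W(a,b,c) = (there is w with w R a, w S b, w T c) contains (x,x,x) by taking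
    w = x, (x,z,z) by taking w = z, and (y,x,z) by taking w = y.  By majority
    it contains (x,x,z), and the resulting w satisfies
    x (R /\ S) w (R /\ T) z. *)

(** * Pullbacks and products *)

Lemma has_pullbacks (C : category) (hL : has_finite_limits C) (X Y Z : C)
    (f : hom X Z) (g : hom Y Z) :
  exists (P : C) (p : hom P X) (q : hom P Y), is_pullback f g p q.
Proof.
pose src (e : bool) : option bool := Some e.
pose tgt (e : bool) : option bool := None.
pose o (v : option bool) : C :=
  match v with Some true => X | Some false => Y | None => Z end.
pose m (e : bool) : hom (o (src e)) (o (tgt e)) :=
  match e return hom (o (src e)) (o (tgt e)) with true => f | false => g end.
have [L [p [pc pU]]] := hL _ _ src tgt (Diagram m).
exists L, (p (Some true)), (p (Some false)); split.
  exact: etrans (pc true) (esym (pc false)).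
move=> S u v uv.
pose q (w : option bool) : hom S (o w) :=
  match w return hom S (o w) with
  | Some true => u | Some false => v | None => f ∘ u end.
have qc : is_cone (D := Diagram m) q by case.
have [h [hq hU]] := pU S q qc.
exists h; split; first by split; [exact: (hq (Some true)) | exact: (hq (Some false))].
move=> k [ku kv]; apply: hU => -[[]|] //.
by rewrite -[RHS]/(f ∘ u) -ku comp_assoc; congr (_ ∘ k); rewrite -(pc true).
Qed.

Lemma pullback_lift (C : category) (X Y Z P : C) (f : hom X Z) (g : hom Y Z)
    (p : hom P X) (q : hom P Y) (S : C) (u : hom S X) (v : hom S Y) :
  is_pullback f g p q -> f ∘ u = g ∘ v ->
  exists h : hom S P, p ∘ h = u /\ q ∘ h = v.
Proof. by move=> [_ pU] /pU [h [hP _]]; exists h. Qed.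

Lemma pullback_jointly_monic (C : category) (X Y Z P : C)
    (f : hom X Z) (g : hom Y Z) (p : hom P X) (q : hom P Y) (S : C)
    (h k : hom S P) :
  is_pullback f g p q -> p ∘ h = p ∘ k -> q ∘ h = q ∘ k -> h = k.
Proof.
move=> [fpgq pU] ph qh.
have sq : f ∘ (p ∘ k) = g ∘ (q ∘ k) by rewrite !comp_assoc fpgq.
have [l [_ lU]] := pU S _ _ sq.
by rewrite -(lU h) // -(lU k).
Qed.

Lemma has_products (C : category) (hL : has_finite_limits C) (X Y : C) :
  exists (P : C) (p : hom P X) (q : hom P Y),
    (forall (S : C) (x : hom S X) (y : hom S Y),
       exists h : hom S P, p ∘ h = x /\ q ∘ h = y) /\
    (forall (S : C) (h k : hom S P), p ∘ h = p ∘ k -> q ∘ h = q ∘ k -> h = k).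
Proof.
pose end_ (e : void) : bool := match e with end.
pose o (v : bool) : C := if v then X else Y.
pose m (e : void) : hom (o (end_ e)) (o (end_ e)) := match e with end.
have [L [p [_ pU]]] := hL _ _ end_ end_ (Diagram m).
have univ (S : C) (x : hom S X) (y : hom S Y) :
    exists! h : hom S L, p true ∘ h = x /\ p false ∘ h = y.
  pose r (v : bool) : hom S (o v) :=
    match v return hom S (o v) with true => x | false => y end.
  have rc : is_cone (D := Diagram m) r by case.
  have [h [hr hU]] := pU S r rc.
  exists h; split; first by split; [exact: (hr true) | exact: (hr false)].
  by move=> k [kx ky]; apply: hU => -[].
exists L, (p true), (p false); split=> [S x y | S h k ph qh].
  by have [h [hP _]] := univ S x y; exists h.
have [l [_ lU]] := univ S (p true ∘ k) (p false ∘ k).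
by rewrite -(lU h) // -(lU k).
Qed.

(** * Regular epimorphisms, local lifts and images *)

Lemma regular_epi_epi (C : category) (X Y Z : C) (e : hom X Y) (u v : hom Y Z) :
  regular_epi e -> u ∘ e = v ∘ e -> u = v.
Proof.
move=> [W [a [b [ab eU]]]] uv.
have sq : (v ∘ e) ∘ a = (v ∘ e) ∘ b by rewrite -!comp_assoc ab.
have [h [_ hU]] := eU _ _ sq.
by rewrite -(hU u) // -(hU v).
Qed.

Lemma local_lift (C : category) (hR : regular C) (A I S : C)
    (q : hom A I) (u : hom S I) :
  regular_epi q ->
  exists (S' : C) (e : hom S' S) (a : hom S' A), regular_epi e /\ q ∘ a = u ∘ e.
Proof.
case: hR => hL _ hP hq; have [P [p [e pb]]] := has_pullbacks hL q u.
by exists P, e, p; split; [exact: hP pb hq | exact: (proj1 pb)].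
Qed.

(** The second factor is monic because two elements of the coequalizer of the
    kernel pair of f lift locally to A; if they agree in B, the lifts form an
    element of the kernel pair, which the coequalizer identifies. *)
Lemma image_factorization (C : category) (hR : regular C) (A B : C)
    (f : hom A B) :
  exists (I : C) (q : hom A I) (m : hom I B),
    [/\ regular_epi q, m ∘ q = f
      & forall (S : C) (u v : hom S I), m ∘ u = m ∘ v -> u = v].
Proof.
have [hL hQ _] := hR.
have [K [k1 [k2 kP]]] := has_pullbacks hL f f.
have [I [q qP]] := hQ _ _ _ f k1 k2 kP.
have hq : regular_epi q by exists K, k1, k2.
have [m [mq _]] := proj2 qP _ f (proj1 kP).
exists I, q, m; split=> // S u v muv.
have [S1 [e1 [a [he1 qa]]]] := local_lift hR u hq.
have [S2 [e2 [b [he2 qb]]]] := local_lift hR (v ∘ e1) hq.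
apply: (regular_epi_epi he1); apply: (regular_epi_epi he2).
have fab : f ∘ (a ∘ e2) = f ∘ b.
  by rewrite -mq -!comp_assoc qb (comp_assoc q) qa !comp_assoc muv.
have [h [ha hb]] := pullback_lift kP fab.
by rewrite -qa -qb -comp_assoc -ha -hb !comp_assoc (proj1 qP).
Qed.

(** * Relations through their generalized elements *)

Lemma related2_comp (C : category) (X Y : C) (R : relation2 X Y) (S S' : C)
    (x : hom S X) (y : hom S Y) (e : hom S' S) :
  related2 R x y -> related2 R (x ∘ e) (y ∘ e).
Proof. by move=> [f [<- <-]]; exists (f ∘ e); rewrite !comp_assoc. Qed.

Lemma rel_leP (C : category) (X Y : C) (R T : relation2 X Y) :
  rel_le R T <->
  forall (S : C) (x : hom S X) (y : hom S Y), related2 R x y -> related2 T x y.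
Proof.
split=> [RT S x y [f [<- <-]] | RT]; first exact: related2_comp.
by apply: RT; exists (idm _); rewrite !comp_idr.
Qed.

(** An element of R over S' whose coordinates come from S coequalizes the pair
    of which e is the coequalizer, since the legs of R are jointly monic; so it
    factors through e. *)
Lemma related2_descent (C : category) (X Y : C) (R : relation2 X Y) (S S' : C)
    (x : hom S X) (y : hom S Y) (e : hom S' S) :
  regular_epi e -> related2 R (x ∘ e) (y ∘ e) -> related2 R x y.
Proof.
move=> he [f [fx fy]]; have [Z [u [v [uv eU]]]] := he.
have [h [hf _]] : exists! h, h ∘ e = f.
  by apply: eU; apply: (rel2_monic (r := R));
     rewrite !comp_assoc ?fx ?fy -!comp_assoc uv.
by exists h; split; apply: (regular_epi_epi he); rewrite -comp_assoc hf.
Qed.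

Lemma related3_descent (C : category) (X Y Z : C) (R : relation3 X Y Z)
    (S S' : C) (x : hom S X) (y : hom S Y) (z : hom S Z) (e : hom S' S) :
  regular_epi e -> related3 R (x ∘ e) (y ∘ e) (z ∘ e) -> related3 R x y z.
Proof.
move=> he [f [fx fy fz]]; have [W [u [v [uv eU]]]] := he.
have [h [hf _]] : exists! h, h ∘ e = f.
  by apply: eU; apply: (rel3_monic (r := R));
     rewrite !comp_assoc ?fx ?fy ?fz -!comp_assoc uv.
by exists h; split; apply: (regular_epi_epi he); rewrite -comp_assoc hf.
Qed.

Lemma image_relation2 (C : category) (hR : regular C) (A X Y : C)
    (f : hom A X) (g : hom A Y) :
  exists D : relation2 X Y,
    (forall (S : C) (u : hom S A), related2 D (f ∘ u) (g ∘ u)) /\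
    (forall (S : C) (x : hom S X) (y : hom S Y), related2 D x y ->
       exists (S' : C) (e : hom S' S) (u : hom S' A),
         [/\ regular_epi e, f ∘ u = x ∘ e & g ∘ u = y ∘ e]).
Proof.
have [hL _ _] := hR.
have [P [p1 [p2 [pE pU]]]] := has_products hL X Y.
have [fg [fgE1 fgE2]] := pE A f g.
have [I [q [m [hq mq hm]]]] := image_factorization hR fg.
have mono (S : C) (h k : hom S I) :
    (p1 ∘ m) ∘ h = (p1 ∘ m) ∘ k -> (p2 ∘ m) ∘ h = (p2 ∘ m) ∘ k -> h = k.
  by rewrite -!comp_assoc => h1 h2; apply: hm; apply: pU.
exists (Relation2 mono); split=> [S u | S x y [i [/= <- <-]]].
  by exists (q ∘ u); rewrite /= !comp_assoc -!(comp_assoc _ m q) mq fgE1 fgE2.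
have [S' [e [a [he qa]]]] := local_lift hR i hq.
exists S', e, a; split=> //.
- by rewrite -fgE1 -mq -!comp_assoc qa.
- by rewrite -fgE2 -mq -!comp_assoc qa.
Qed.

Lemma image_relation3 (C : category) (hR : regular C) (A X Y Z : C)
    (f : hom A X) (g : hom A Y) (h : hom A Z) :
  exists D : relation3 X Y Z,
    (forall (S : C) (u : hom S A), related3 D (f ∘ u) (g ∘ u) (h ∘ u)) /\
    (forall (S : C) (x : hom S X) (y : hom S Y) (z : hom S Z),
       related3 D x y z ->
       exists (S' : C) (e : hom S' S) (u : hom S' A),
         [/\ regular_epi e, f ∘ u = x ∘ e, g ∘ u = y ∘ e & h ∘ u = z ∘ e]).
Proof.
have [hL _ _] := hR.
have [P [p1 [p2 [pE pU]]]] := has_products hL X Y.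
have [Q [q1 [q2 [qE qU]]]] := has_products hL P Z.
have [fg [fgE1 fgE2]] := pE A f g.
have [fgh [fghE1 fghE2]] := qE A fg h.
have [I [q [m [hq mq hm]]]] := image_factorization hR fgh.
have mono (S : C) (i j : hom S I) :
    (p1 ∘ q1 ∘ m) ∘ i = (p1 ∘ q1 ∘ m) ∘ j ->
    (p2 ∘ q1 ∘ m) ∘ i = (p2 ∘ q1 ∘ m) ∘ j ->
    (q2 ∘ m) ∘ i = (q2 ∘ m) ∘ j -> i = j.
  by rewrite -!comp_assoc => h1 h2 h3; apply: hm; apply: qU => //; apply: pU.
exists (Relation3 mono); split=> [S u | S x y z [i [/= <- <- <-]]].
  exists (q ∘ u).
  by rewrite /= !comp_assoc -!(comp_assoc _ m q) mq -!(comp_assoc _ q1) fghE1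
             fghE2 fgE1 fgE2.
have [S' [e [a [he qa]]]] := local_lift hR i hq.
exists S', e, a; split=> //.
- by rewrite -fgE1 -fghE1 -mq -!comp_assoc qa.
- by rewrite -fgE2 -fghE1 -mq -!comp_assoc qa.
- by rewrite -fghE2 -mq -!comp_assoc qa.
Qed.

Lemma composite_relation (C : category) (hR : regular C) (X Y Z : C)
    (R : relation2 X Y) (T : relation2 Y Z) :
  exists D : relation2 X Z,
    (forall (S : C) (x : hom S X) (y : hom S Y) (z : hom S Z),
       related2 R x y -> related2 T y z -> related2 D x z) /\
    (forall (S : C) (x : hom S X) (z : hom S Z), related2 D x z ->
       exists (S' : C) (e : hom S' S) (y : hom S' Y),
         [/\ regular_epi e, related2 R (x ∘ e) y & related2 T y (z ∘ e)]).
Proof.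
have [hL _ _] := hR.
have [P [p [q pb]]] := has_pullbacks hL (rel2_2 R) (rel2_1 T).
have [D [Di De]] := image_relation2 hR (rel2_1 R ∘ p) (rel2_2 T ∘ q).
exists D; split=> [S x y z [r [<- ry]] [t [ty <-]] | S x z /De].
  have [u [<- <-]] := pullback_lift pb (etrans ry (esym ty)).
  by rewrite !comp_assoc.
move=> [S' [e [u [he ux uz]]]].
exists S', e, (rel2_2 R ∘ p ∘ u); rewrite -ux -uz; split=> //.
- by exists (p ∘ u); rewrite !comp_assoc.
- by exists (q ∘ u); rewrite !comp_assoc (proj1 pb).
Qed.

(** The image of the object of quadruples (w, a, b, c) with w R a, w P b and
    w T c. *)
Lemma common_related_relation (C : category) (hR : regular C) (W X Y Z : C)
    (R : relation2 W X) (P : relation2 W Y) (T : relation2 W Z) :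
  exists D : relation3 X Y Z,
    (forall (S : C) (w : hom S W) (a : hom S X) (b : hom S Y) (c : hom S Z),
       related2 R w a -> related2 P w b -> related2 T w c -> related3 D a b c) /\
    (forall (S : C) (a : hom S X) (b : hom S Y) (c : hom S Z),
       related3 D a b c ->
       exists (S' : C) (e : hom S' S) (w : hom S' W),
         [/\ regular_epi e, related2 R w (a ∘ e), related2 P w (b ∘ e)
           & related2 T w (c ∘ e)]).
Proof.
have [hL _ _] := hR.
have [Q [q1 [q2 qb]]] := has_pullbacks hL (rel2_1 R) (rel2_1 P).
have [V [v1 [v2 vb]]] := has_pullbacks hL (rel2_1 R ∘ q1) (rel2_1 T).
have [D [Di De]] :=
  image_relation3 hR (rel2_2 R ∘ q1 ∘ v1) (rel2_2 P ∘ q2 ∘ v1) (rel2_2 T ∘ v2).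
exists D; split=> [S w a b c [r [rw <-]] [p [pw <-]] [t [tw <-]] | S a b c /De].
  have [u [ur <-]] := pullback_lift qb (etrans rw (esym pw)).
  have uw : rel2_1 R ∘ q1 ∘ u = rel2_1 T ∘ t by rewrite -comp_assoc ur rw tw.
  have [v [vu <-]] := pullback_lift vb uw.
  by rewrite -ur -vu !comp_assoc.
move=> [S' [e [u [he ua ub uc]]]].
exists S', e, (rel2_1 R ∘ q1 ∘ v1 ∘ u); rewrite -ua -ub -uc; split=> //.
- by exists (q1 ∘ v1 ∘ u); rewrite !comp_assoc.
- by exists (q2 ∘ v1 ∘ u); rewrite !comp_assoc (proj1 qb).
- by exists (v2 ∘ u); rewrite !comp_assoc (proj1 vb).
Qed.

Lemma kernel_eqrel (C : category) (hL : has_finite_limits C) (X Y : C)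
    (f : hom X Y) :
  exists E : eqrel X, forall (S : C) (x y : hom S X),
    related2 E x y <-> f ∘ x = f ∘ y.
Proof.
have [K [k1 [k2 pb]]] := has_pullbacks hL f f.
have mono (S : C) (h k : hom S K) :
    k1 ∘ h = k1 ∘ k -> k2 ∘ h = k2 ∘ k -> h = k.
  exact: pullback_jointly_monic pb.
pose R := Relation2 mono.
have RP (S : C) (x y : hom S X) : related2 R x y <-> f ∘ x = f ∘ y.
  split=> [[h [/= <- <-]] | ]; first by rewrite !comp_assoc (proj1 pb).
  exact: pullback_lift.
have Rr (S : C) (x : hom S X) : related2 R x x by apply/RP.
have Rs (S : C) (x y : hom S X) : related2 R x y -> related2 R y x.
  by move=> /RP xy; apply/RP.
have Rt (S : C) (x y z : hom S X) :
    related2 R x y -> related2 R y z -> related2 R x z.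
  by move=> /RP xy /RP yz; apply/RP; rewrite xy.
by exists (EqRel Rr Rs Rt).
Qed.

(** * Meets and joins of equivalence relations *)

Lemma has_meets (C : category) (hL : has_finite_limits C) (X : C)
    (R T : eqrel X) :
  exists M : eqrel X, is_meet R T M /\
    forall (S : C) (x y : hom S X),
      related2 M x y <-> related2 R x y /\ related2 T x y.
Proof.
have [P [p1 [p2 [pE pU]]]] := has_products hL X X.
have [r [r1 r2]] := pE _ (rel2_1 R) (rel2_2 R).
have [t [t1 t2]] := pE _ (rel2_1 T) (rel2_2 T).
have [Q [p [q pb]]] := has_pullbacks hL r t.
have pq1 : rel2_1 R ∘ p = rel2_1 T ∘ q.
  by rewrite -r1 -t1 -!comp_assoc (proj1 pb).
have pq2 : rel2_2 R ∘ p = rel2_2 T ∘ q.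
  by rewrite -r2 -t2 -!comp_assoc (proj1 pb).
have mono (S : C) (h k : hom S Q) :
    (rel2_1 R ∘ p) ∘ h = (rel2_1 R ∘ p) ∘ k ->
    (rel2_2 R ∘ p) ∘ h = (rel2_2 R ∘ p) ∘ k -> h = k.
  move=> h1 h2; apply: (pullback_jointly_monic pb).
    by apply: (rel2_monic (r := R)); rewrite !comp_assoc.
  by apply: (rel2_monic (r := T)); rewrite !comp_assoc -?pq1 -?pq2.
pose N := Relation2 mono.
have NP (S : C) (x y : hom S X) :
    related2 N x y <-> related2 R x y /\ related2 T x y.
  split=> [[h [/= <- <-]] | [[f [fx fy]] [g [gx gy]]]].
    split; first by exists (p ∘ h); rewrite !comp_assoc.
    by exists (q ∘ h); rewrite !comp_assoc pq1 pq2.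
  have [h [hf hg]] : exists h, p ∘ h = f /\ q ∘ h = g.
    apply: (pullback_lift pb).
    by apply: pU; rewrite !comp_assoc ?r1 ?r2 ?t1 ?t2 ?fx ?fy ?gx ?gy.
  by exists h; rewrite /= -!comp_assoc hf.
have Nr (S : C) (x : hom S X) : related2 N x x.
  by apply/NP; split; apply: eqrel_refl.
have Ns (S : C) (x y : hom S X) : related2 N x y -> related2 N y x.
  by move=> /NP[xRy xTy]; apply/NP; split; apply: eqrel_sym.
have Nt (S : C) (x y z : hom S X) :
    related2 N x y -> related2 N y z -> related2 N x z.
  move=> /NP[xRy xTy] /NP[yRz yTz]; apply/NP.
  by split; [apply: eqrel_trans yRz | apply: eqrel_trans yTz].
exists (EqRel Nr Ns Nt); split=> //; split=> [||M /rel_leP MR /rel_leP MT].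
- by apply/rel_leP => S x y /NP[].
- by apply/rel_leP => S x y /NP[].
- by apply/rel_leP => S x y xMy; apply/NP; split; [apply: MR | apply: MT].
Qed.

Lemma meet_related (C : category) (hL : has_finite_limits C) (X : C)
    (R T M : eqrel X) (S : C) (x y : hom S X) :
  is_meet R T M -> (related2 M x y <-> related2 R x y /\ related2 T x y).
Proof.
move=> [/rel_leP MR /rel_leP MT Mmax]; split=> [xMy | xNy].
  by split; [apply: MR | apply: MT].
have [N [[NR NT _] NP]] := has_meets hL R T.
by have /rel_leP := Mmax N NR NT; apply; apply/NP.
Qed.

(** Difunctionality turns x D y into y D x by the three related pairs
    (x,x), (x,y), (y,y), and chains x D y D z by (y,z), (y,y), (x,y). *)
Lemma maltsev_eqrel (C : category) (hM : maltsev C) (X : C)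
    (D : relation2 X X) :
  (forall (S : C) (x : hom S X), related2 D x x) ->
  exists E : eqrel X, E = D :> relation2 X X.
Proof.
move=> Dr.
have Ds (S : C) (x y : hom S X) : related2 D x y -> related2 D y x.
  by move=> xy; apply: (hM _ _ D _ x y y x).
have Dt (S : C) (x y z : hom S X) :
    related2 D x y -> related2 D y z -> related2 D x z.
  by move=> xy yz; apply: (hM _ _ D _ y x y z).
by exists (EqRel Dr Ds Dt).
Qed.

(** The composite of R and T is reflexive, hence an equivalence relation, and
    transitivity puts it below every equivalence relation containing R and T. *)
Lemma has_joins (C : category) (hR : regular C) (hM : maltsev C) (X : C)
    (R T : eqrel X) :
  exists J : eqrel X, is_join R T J /\
    forall (S : C) (x z : hom S X), related2 J x z ->
      exists (S' : C) (e : hom S' S) (y : hom S' X),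
        [/\ regular_epi e, related2 R (x ∘ e) y & related2 T y (z ∘ e)].
Proof.
have [D [Di De]] := composite_relation hR R T.
have Dr (S : C) (x : hom S X) : related2 D x x.
  by apply: (Di _ x x x); apply: eqrel_refl.
have [J JD] := maltsev_eqrel hM Dr.
exists J; rewrite /is_join JD; split=> //.
split=> [||N /rel_leP RN /rel_leP TN]; apply/rel_leP => S x z.
- by move=> xRz; apply: (Di _ x z z) => //; apply: eqrel_refl.
- by move=> xTz; apply: (Di _ x x z) => //; apply: eqrel_refl.
- move=> /De[S' [e [y [he xRy yTz]]]]; apply: (related2_descent he).
  exact: eqrel_trans (RN _ _ _ xRy) (TN _ _ _ yTz).
Qed.

(** A join is only determined up to mutual inclusion; this transfers the
    description by local witnesses from the composite to an arbitrary join. *)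
Lemma join_related (C : category) (hR : regular C) (hM : maltsev C) (X : C)
    (R T J : eqrel X) (S : C) (x z : hom S X) :
  is_join R T J ->
  (related2 J x z <->
   exists (S' : C) (e : hom S' S) (y : hom S' X),
     [/\ regular_epi e, related2 R (x ∘ e) y & related2 T y (z ∘ e)]).
Proof.
move=> [/rel_leP RJ /rel_leP TJ Jmin]; split=> [xJz | [S' [e [y [he xRy yTz]]]]].
  have [K [[RK TK _]]] := has_joins hR hM R T; apply.
  by have /rel_leP := Jmin K RK TK; apply.
apply: (related2_descent he).
exact: eqrel_trans (RJ _ _ _ xRy) (TJ _ _ _ yTz).
Qed.

(** * Majority and distributivity *)

Lemma distributive_majority (C : category) (hR : regular C) (hM : maltsev C)
    (hD : congruence_distributive C) :
  majority C.
Proof.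
have [hL _ _] := hR.
move=> X Y Z R S a1 a2 b1 b2 c1 c2.
move=> [f1 [f1a f1b f1c]] [f2 [f2a f2b f2c]] [f3 [f3a f3b f3c]].
have [A AP] := kernel_eqrel hL (rel3_1 R).
have [B BP] := kernel_eqrel hL (rel3_2 R).
have [G GP] := kernel_eqrel hL (rel3_3 R).
have [_ _ dist] := hD (rel3_ob R).
have [BG [hBG _]] := has_joins hR hM B G.
have [L [hL' LP]] := has_meets hL A BG.
have [AB [hAB ABP]] := has_meets hL A B.
have [AG [hAG AGP]] := has_meets hL A G.
have [M [hM' MP]] := has_joins hR hM AB AG.
have [/rel_leP LM _] := dist _ _ _ _ _ _ _ _ hBG hL' hAB hAG hM'.
have f12 : related2 L f1 f2.
  apply/LP; split; first by apply/AP; rewrite f1a f2a.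
  have [/rel_leP BJ /rel_leP GJ _] := hBG.
  apply: (eqrel_trans (y := f3)); first by apply/BJ/BP; rewrite f1b f3b.
  by apply/GJ/GP; rewrite f3c f2c.
have [S' [e [w [he /ABP[/AP wa /BP wb] /AGP[_ /GP wc]]]]] := MP _ _ _ (LM _ _ _ f12).
apply: (related3_descent he); exists w; split.
- by rewrite -wa comp_assoc f1a.
- by rewrite -wb comp_assoc f1b.
- by rewrite wc comp_assoc f2c.
Qed.

Lemma majority_distributive (C : category) (hR : regular C) (hM : maltsev C)
    (hMaj : majority C) :
  congruence_distributive C.
Proof.
have [hL _ _] := hR.
move=> X; split=> [R T | R T | R P T PT RP RT L M hPT hL' hRP hRT hM'].
- by have [N [? _]] := has_meets hL R T; exists N.
- by have [J [? _]] := has_joins hR hM R T; exists J.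
have LP S (x y : hom S X) := meet_related hL x y hL'.
have RPP S (x y : hom S X) := meet_related hL x y hRP.
have RTP S (x y : hom S X) := meet_related hL x y hRT.
split; last first.
  have [/rel_leP PPT /rel_leP TPT _] := hPT.
  have [_ _ Mmin] := hM'.
  apply: Mmin; apply/rel_leP => S x y.
    by move=> /RPP[xRy xPy]; apply/LP; split=> //; apply: PPT.
  by move=> /RTP[xRy xTy]; apply/LP; split=> //; apply: TPT.
apply/rel_leP => S x z /LP[xRz].
move=> /(join_related hR hM _ _ hPT)[S1 [e1 [y [he1 xPy yTz]]]].
apply: (related2_descent he1).
move: (x ∘ e1) (z ∘ e1) xPy yTz (related2_comp e1 xRz) => {}x {}z xPy yTz {}xRz.
have [W [Wi We]] := common_related_relation hR R P T.
have /We[S2 [e2 [w [he2 wRx wPx wTz]]]] : related3 W x x z.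
  (* The witnesses for the three triples are x, z and y, in this order. *)
  apply: (hMaj _ _ _ W _ x y x z z x).
  - by apply: (Wi _ x); apply: eqrel_refl.
  - by apply: (Wi _ z); [apply: eqrel_sym | apply: eqrel_refl | apply: eqrel_refl].
  - by apply: (Wi _ y) => //; [apply: eqrel_refl | apply: eqrel_sym].
apply/(join_related hR hM _ _ hM'); exists S2, e2, w; split=> //.
- by apply/RPP; split; apply: eqrel_sym.
- by apply/RTP; split=> //; apply: eqrel_trans wRx (related2_comp e2 xRz).
Qed.

Theorem corollary3 (C : category) (hC : barr_exact C) :
  arithmetical C <-> maltsev C /\ majority C.
Proof.
have [hR _] := hC.
split=> [[_ hM hD] | [hM hMaj]].
  by split=> //; apply: distributive_majority.
by split=> //; apply: majority_distributive.
Qed.
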